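(* If $G$ is a $2$-connected graph, then $\mathrm{lec}(G)=\min\{3,\mathrm{rc}(G)\}$.
   Context: Graphs are finite, simple, undirected. Given an edge-colouring $\varphi:E(G)\to[1,k]$, a path is loose if it consists of exactly one edge, or of exactly two edges of different colours, or has at least three edges coloured with at least three distinct colours. $\mathrm{lec}(G)$ is the least $k$ for which there is an edge-colouring with $k$ colours such that every two distinct vertices are joined by a loose path. $\mathrm{rc}(G)$ (rainbow connection number) is the least $k$ for which there is an edge-colouring with $k$ colours such that every two distinct vertices are joined by a path whose edges have pairwise distinct colours. *)

(* Defs.v *)
From mathcomp Require Import all_boot.
From mathcomp Require Import boolp.

Set Implicit Arguments.
Unset Strict Implicit.
Unset Printing Implicit Defensive.

Record sgraph := SGraph {
  vertex :> finType;
  adj : rel vertex;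
  adj_sym : symmetric adj;
  adj_irrefl : irreflexive adj }.

Definition induced_connected (G : sgraph) (A : {set G}) : bool :=
  (A != set0) &&
  [forall x in A, forall y in A,
     connect [rel u v | [&& u \in A, v \in A & adj u v]] x y].

Definition connected_graph (G : sgraph) : bool := induced_connected [set: G].

(* As in Diestel, a [k]-connected graph has more than [k] vertices, so that a
   2-connected graph has at least three; [~: X] stands for [G - X]. *)
Definition k_connected (k : nat) (G : sgraph) : bool :=
  (k < #|G|) && [forall X : {set G}, (#|X| < k) ==> induced_connected (~: X)].

(* A path is given by its first vertex [x] and the sequence [p] of the
   others. *)
Definition graph_path (G : sgraph) (x y : G) (p : seq G) : bool :=
  [&& path (@adj G) x p, uniq (x :: p) & last x p == y].

Definition path_edges (G : sgraph) (x : G) (p : seq G) : seq {set G} :=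
  pairmap (fun u v => [set u; v]) x p.

(* The values of [c] at sets that are not edges are irrelevant. *)
Definition edge_coloring (G : sgraph) (k : nat) (c : {set G} -> nat) : Prop :=
  forall u v : G, adj u v -> 1 <= c [set u; v] <= k.

(* [loose] and [rainbow] are properties of the sequence of colours read along
   a path; [size (undup s)] is the number of distinct colours in [s]. *)
Definition loose (s : seq nat) : bool :=
  [|| size s == 1,
      (size s == 2) && uniq s
    | (3 <= size s) && (3 <= size (undup s))].

Definition rainbow (s : seq nat) : bool := uniq s.

Definition joins_all (good : pred (seq nat)) (G : sgraph) (k : nat) : Prop :=
  exists2 c : {set G} -> nat, edge_coloring k c &
    forall x y : G, x != y ->
      exists2 p : seq G, graph_path x y p & good (map c (path_edges x p)).

(* The value 0 when [P] is empty is a dummy. It is not used for [lec] and [rc]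
   of a connected graph, see [lecP] and [rcP]. *)
Definition least (P : nat -> Prop) : nat :=
  if pselect (exists n, `[< P n >]) is left exP then ex_minn exP else 0.

Definition lec (G : sgraph) : nat := least (joins_all loose G).

Definition rc (G : sgraph) : nat := least (joins_all rainbow G).

Lemma leastP (P : nat -> Prop) :
  (exists n, P n) -> P (least P) /\ forall n, P n -> least P <= n.
Proof.
move=> [n0 Pn0]; rewrite /least; case: pselect => [exP|[]]; last first.
  by exists n0; apply/asboolP.
case: ex_minnP => m /asboolP Pm min_m; split=> // n Pn.
by apply: min_m; apply/asboolP.
Qed.

Lemma path_edges_sub (G : sgraph) (x : G) p e :
  e \in path_edges x p -> {subset e <= x :: p}.
Proof.
elim: p x => [|y p IH] x //=; rewrite inE => /orP[/eqP->|/IH sub] z.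
  by rewrite !inE => /orP[] ->; rewrite ?orbT.
by move=> /sub zp; rewrite inE zp orbT.
Qed.

Lemma path_edges_uniq (G : sgraph) (x : G) p :
  uniq (x :: p) -> uniq (path_edges x p).
Proof.
elim: p x => [|y p IH] x //= /andP[xp up]; rewrite IH // andbT.
apply: contra xp => /path_edges_sub; apply; exact: set21.
Qed.

Lemma joins_all_rainbow (G : sgraph) :
  connected_graph G -> exists k, joins_all rainbow G k.
Proof.
case/andP=> _ /forall_inP conG; exists #|{set G}|.
exists (fun e => (enum_rank e).+1) => [u v _|x y _]; first exact: ltn_ord.
have /forall_inP/(_ y (in_setT y)) := conG x (in_setT x).
case/connectP => p0 /shortenP[p pth up _ ->].
exists p; first rewrite /graph_path up eqxx !andbT.
  by apply: sub_path pth => u v /= /and3P[].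
rewrite /rainbow map_inj_uniq ?path_edges_uniq //.
by move=> e f /succn_inj/val_inj/enum_rank_inj.
Qed.

Lemma joins_all_rainbow_loose (G : sgraph) k :
  joins_all rainbow G k -> joins_all loose G k.
Proof.
case=> c ck H; exists c => // x y xy; have [p pp us] := H x y xy.
exists p => //; move: us; rewrite /rainbow /loose => us.
rewrite us (undup_id us) andbT andbb size_map size_pairmap.
case: p pp {us} => [|a [|b [|d p]]] //= /and3P[_ _ /eqP/= eqxy].
by rewrite eqxy eqxx in xy.
Qed.

Lemma rcP (G : sgraph) : connected_graph G ->
  joins_all rainbow G (rc G) /\ forall k, joins_all rainbow G k -> rc G <= k.
Proof. by move/joins_all_rainbow/leastP. Qed.

Lemma lecP (G : sgraph) : connected_graph G ->
  joins_all loose G (lec G) /\ forall k, joins_all loose G k -> lec G <= k.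
Proof.
move=> /joins_all_rainbow[k /joins_all_rainbow_loose jk].
by apply: leastP; exists k.
Qed.

(* Main.v *)
(* A loose path with at most two colours is rainbow, so it is enough to find a
   loose colouring with three colours.  Fix an edge [ab]; colour [ab] with 1, the
   other edges at [b] with 2, and the edges between a neighbour of [b] and a
   vertex other than [b] with 3.  By 2-connectedness two vertices other than
   [b] are joined by a path through [ab], on which [b] is interior: it has the
   colours 1 and 2, and also 3 unless its length is 2.  A vertex at distance 2
   from [b] is reached with colours (1 or 2), 3; the colours 1 and 2 of the edges
   leaving the ball of radius 2 are chosen so that a path [b z w t] across its
   boundary can have all three colours. *)
Require Import Defs.
From mathcomp Require Import all_boot zify.

Set Implicit Arguments.
Unset Strict Implicit.
Unset Printing Implicit Defensive.

(** * Connectivity and avoidance of a vertex *)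

Lemma adj_neq (G : sgraph) (u v : G) : adj u v -> u != v.
Proof. by move=> uv; apply: contraTneq uv => ->; rewrite adj_irrefl. Qed.

(** The hit [z] is kept apart from [r] because another path inside [S] gets spliced on at [z]: the
    result has no repeated vertex since everything before [z] is outside [S]. *)
Lemma connect_first_hit (T : finType) (e : rel T) (S : pred T) x y :
  connect e x y -> ~~ S x -> S y ->
  exists r z, [/\ path e x (rcons r z), uniq (x :: rcons r z), S z &
                  ~~ has S (x :: r)].
Proof.
case/connectP => p0 /shortenP[p pth up _ ->] nSx Sy.
have hasp : has S p.
  case/lastP: p Sy {pth up} => [|p z] /=; first by rewrite (negPf nSx).
  by rewrite last_rcons has_rcons => ->.
case: (split_find hasp) pth up => z r r2 Sz nr.
rewrite cat_path -cat_cons cat_uniq => /andP[pth _] /andP[up _].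
by exists r, z; split=> //=; rewrite negb_or nSx.
Qed.

Lemma k_connected_connected (G : sgraph) k :
  k_connected k.+1 G -> connected_graph G.
Proof. by case/andP=> _ /forallP/(_ set0)/implyP; rewrite cards0 setC0; apply. Qed.

Lemma two_connected_avoid (G : sgraph) (v x y : G) :
  k_connected 2 G -> x != v -> y != v ->
  connect [rel s t | [&& s != v, t != v & adj s t]] x y.
Proof.
case/andP=> _ /forallP/(_ [set v])/implyP; rewrite cards1 => /(_ isT).
case/andP=> _ /forall_inP H xv yv.
have /H/forall_inP/(_ y) : x \in ~: [set v] by rewrite !inE.
rewrite !inE => /(_ yv); apply: connect_sub => s t.
by rewrite /= !inE => ?; apply: connect1.
Qed.

(** * Disjoint paths to two given vertices *)

(* There are disjoint paths from [u] and [w] to the two vertices [a], [b], in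
   either order. *)
Definition linked (G : sgraph) (a b u w : G) := exists p q : seq G,
  [/\ path (@adj G) u p, path (@adj G) w q, uniq ((u :: p) ++ (w :: q)) &
      (last u p, last w q) \in [:: (a, b); (b, a)]].

Lemma linked_sym (G : sgraph) (a b u w : G) : linked a b u w -> linked a b w u.
Proof.
case=> p [q [pp qq upq]]; rewrite !inE !xpair_eqE => ends.
by exists q, p; rewrite uniq_catC !inE !xpair_eqE orbC andbC [X in _ || X]andbC.
Qed.

(* If [u'] lies on the path [q] from [w], follow a path from [w] to [u] in [G - u']
   up to its first hit on [p] or on the part of [q] after [u'].  If it hits [p],
   the two paths exchange their ends; if it hits [q], then [u'] is put in front
   of [p]. *)
Lemma linked_step (G : sgraph) (a b u u' w : G) : k_connected 2 G ->
  linked a b u w -> adj u u' -> u' != w -> linked a b u' w.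
Proof.
move=> conG [p [q [pp qq upq ends]]] uu' u'w.
have u'u : u != u' by apply: adj_neq.
(* Two easy cases come first: if [u'] lies on [p], the path from [u] is cut at [u']; if it lies on
   neither path, it is extended backwards to [u']. *)
have [u'p|u'Np] := boolP (u' \in p).
  case/splitPr: p / u'p pp upq ends => p1 p2.
  rewrite cat_path last_cat /= => /and3P[_ _ pp2] /andP[_].
  rewrite -catA cat_uniq => /and3P[_ _ upq] ends.
  by exists p2, q.
have [u'q|u'Nq] := boolP (u' \in q); last first.
  exists (u :: p), q; split=> //; first by rewrite /= adj_sym uu'.
  rewrite cat_cons cons_uniq upq andbT !(inE, mem_cat) !negb_or.
  by rewrite eq_sym u'u u'Np u'w u'Nq.
case/splitPr: q / u'q qq upq ends => q1 q2 + upq.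
rewrite cat_path last_cat /= => /and3P[_ _ qq2] ends.
have wu' : w != u' by rewrite eq_sym.
(* The detour from [w] aims at [(u :: p) ++ q2], which is what remains of both paths once [w], [q1]
   and [u'] are removed. *)
have {upq} [uS wNS] : uniq (u' :: (u :: p) ++ q2) /\ w \notin (u :: p) ++ q2.
  have up : perm_eq (w :: q1 ++ u' :: (u :: p) ++ q2)
                    (u :: p ++ w :: q1 ++ u' :: q2).
    by apply/permP => f; rewrite /= !count_cat /= !count_cat /=; clear; lia.
  move: upq; rewrite cat_cons -(perm_uniq up) -(cat_cons w) cat_uniq => /and3P[_ /hasPn H uS].
  split=> //; apply/negP => wS; have /H : w \in u' :: (u :: p) ++ q2 by rewrite inE wS orbT.
  by rewrite /= mem_head.
have uInS : u \in (u :: p) ++ q2 by rewrite mem_head.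
have [r [z [pr ur Sz nSr]]] :=
  connect_first_hit (two_connected_avoid conG wu' u'u) wNS uInS.
have pr' : path (@adj G) w (rcons r z).
  by apply: sub_path pr => s t /and3P[].
have u'Nr : u' \notin w :: r.
  rewrite inE negb_or u'w /=; move: pr; rewrite rcons_path => /andP[pr _].
  elim: r w pr {wu' u'w wNS ends qq2 ur nSr pr'} => //= t r IH w.
  by case/andP => /and3P[_ tu' _] /IH; rewrite inE negb_or eq_sym tu'.
(* Before its hit the detour meets neither [u'] nor its target, so [w :: r] can be inserted into any
   duplicate-free sequence of such vertices. *)
have uniq_insert A B : uniq (A ++ B) -> {subset A ++ B <= u' :: (u :: p) ++ q2} ->
    uniq (A ++ (w :: r) ++ B).
  move=> uAB sAB; rewrite uniq_catCA cat_uniq uAB andbT.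
  move: ur; rewrite -rcons_cons rcons_uniq => /andP[_ ->] /=.
  apply/hasPn => t /sAB; rewrite inE => /orP[/eqP->//|tS].
  by apply: contraNN nSr => tr; apply/hasP; exists t.
have {Sz} : z \in (u :: p) ++ q2 := Sz; rewrite mem_cat => /orP[zp|zq].
  have [p1 [p2 pE]] : exists p1 p2, u :: p = p1 ++ z :: p2.
    by case/splitPr: zp => p1 p2; exists p1, p2.
  have /andP[pp2 lp2] : path (@adj G) z p2 && (last u p == last z p2).
    by case: p1 pE pp => [|? p1] [-> ->] /=;
      rewrite ?cat_path ?last_cat /= ?eqxx ?andbT => // /and3P[].
  exists q2, (rcons r z ++ p2); split=> //.
  - by rewrite cat_path pr' last_rcons.
  - rewrite cat_rcons -(cat_cons w); apply: uniq_insert.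
      have up : perm_eq (p1 ++ (u' :: q2) ++ z :: p2) (u' :: (u :: p) ++ q2).
        rewrite pE; apply/permP => f; rewrite /= !count_cat /= !count_cat /=; clear; lia.
      by move: uS; rewrite -(perm_uniq up) (cat_uniq p1) => /and3P[].
    by move=> t; rewrite pE !(inE, mem_cat) => /orP[/orP[]|/orP[]] ->; rewrite ?orbT.
  - rewrite last_cat last_rcons -(eqP lp2); move: ends.
    by rewrite !inE !xpair_eqE orbC andbC [X in _ || X]andbC.
case/splitPr: zq qq2 ends uS uniq_insert {nSr wNS uInS} => s1 s2 + + uS uniq_insert.
rewrite cat_path last_cat /= => /and3P[_ _ qs2] ends.
exists (u :: p), (rcons r z ++ s2); split.
- by rewrite /= adj_sym uu'.
- by rewrite cat_path pr' last_rcons.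
- rewrite cat_rcons -(cat_cons w); apply: uniq_insert.
    have up : perm_eq (s1 ++ (u' :: u :: p) ++ z :: s2) (u' :: (u :: p) ++ s1 ++ z :: s2).
      apply/permP => f; rewrite !count_cat /= !count_cat /= ?count_cat /=; clear; lia.
    by move: uS; rewrite -(perm_uniq up) (cat_uniq s1) => /and3P[].
  by move=> t; rewrite !(inE, mem_cat) => /orP[/or3P[]|/orP[]] ->; rewrite ?orbT.
- by rewrite last_cat last_rcons.
Qed.

(** Start with the trivial paths at [a] and [b] and move one starting point at a time by
    [linked_step]: first [a] to [x] along a path in [G - b], then [b] to [y] along a path in
    [G - x]. *)
Lemma linked_edge (G : sgraph) (a b x y : G) : k_connected 2 G ->
  a != b -> x != b -> y != x -> linked a b x y.
Proof.
move=> conG ab xb yx; apply: linked_sym.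
have walk v s t w : connect [rel s t | [&& s != v, t != v & adj s t]] s t ->
    linked a b s w -> w = v -> linked a b t w.
  case/connectP => p pth -> + wv; elim: p s pth => //= t' p IH s.
  case/andP => /and3P[_ t'v st'] pth Ls; apply: IH pth _.
  by apply: linked_step Ls st' _; rewrite // wv.
apply: (@walk x b y x) => //.
  by apply: two_connected_avoid; rewrite // eq_sym.
apply: linked_sym; apply: (@walk b a x b) => //.
  exact: two_connected_avoid.
by exists [::], [::]; rewrite /= !inE ab eqxx.
Qed.

(** * Edges of paths, reversal and loosely joined pairs *)

Lemma path_edges_cat (G : sgraph) (x : G) p q :
  path_edges x (p ++ q) = path_edges x p ++ path_edges (last x p) q.
Proof. by rewrite /path_edges pairmap_cat. Qed.

Lemma path_edges_last (G : sgraph) (x : G) (p : seq G) : p != [::] ->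
  exists2 u, u \in x :: p & [set u; last x p] \in path_edges x p.
Proof.
case/lastP: p => // p v _; exists (last x p).
  by rewrite -rcons_cons mem_rcons inE mem_last orbT.
by rewrite last_rcons -cats1 path_edges_cat mem_cat /= inE eqxx orbT.
Qed.

(** The reversed path starts at [last x p]; its other vertices are therefore those of [belast x p],
    which includes [x] and omits the last vertex. *)
Lemma path_edges_rev (G : sgraph) (x : G) p :
  path_edges (last x p) (rev (belast x p)) = rev (path_edges x p).
Proof.
elim: p x => //= y p IH x.
rewrite rev_cons -cats1 path_edges_cat IH rev_cons -cats1 /=; congr (_ ++ [:: _]).
have -> : last (last y p) (rev (belast y p)) = y.
  by case: p {IH} => //= z p; rewrite rev_cons last_rcons.
by rewrite setUC.
Qed.

Lemma graph_path_rev (G : sgraph) (x y : G) p :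
  graph_path x y p -> graph_path y x (rev (belast x p)).
Proof.
case/and3P => pp up /eqP <-; apply/and3P; split.
- by rewrite rev_path; apply: sub_path pp => s t; rewrite adj_sym.
- by rewrite -rev_rcons -lastI rev_uniq.
- by case: p {pp up} => //= z p; rewrite rev_cons last_rcons.
Qed.

Lemma loose_rev s : loose (rev s) = loose s.
Proof.
rewrite /loose size_rev rev_uniq; congr [|| _, _ | _ && (_ < _)].
by apply: perm_size; apply: uniq_perm; rewrite ?undup_uniq // => i; rewrite !mem_undup mem_rev.
Qed.

Definition loosely_joined (G : sgraph) (c : {set G} -> nat) (x y : G) :=
  exists2 p, graph_path x y p & loose (map c (path_edges x p)).

Lemma loosely_joined_sym (G : sgraph) (c : {set G} -> nat) (x y : G) :
  loosely_joined c x y -> loosely_joined c y x.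
Proof.
case=> p gp lp; exists (rev (belast x p)); first exact: graph_path_rev.
by have /and3P[_ _ /eqP <-] := gp; rewrite path_edges_rev map_rev loose_rev.
Qed.

Lemma loosely_joined_adj (G : sgraph) (c : {set G} -> nat) (x y : G) :
  adj x y -> loosely_joined c x y.
Proof.
move=> xy; exists [:: y] => //; rewrite /graph_path /= xy eqxx inE !andbT.
exact: adj_neq.
Qed.

Lemma loosely_joined_path2 (G : sgraph) (c : {set G} -> nat) (x z y : G) :
  x != y -> adj x z -> adj z y -> c [set x; z] != c [set z; y] ->
  loosely_joined c x y.
Proof.
move=> xy xz zy cc; exists [:: z; y]; last by rewrite /loose /= inE cc.
rewrite /graph_path /= xz zy eqxx !inE negb_or xy !andbT /=.
by rewrite !adj_neq.
Qed.

Lemma loose_three_colors (s : seq nat) :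
  {subset [:: 1; 2; 3] <= s} -> loose s.
Proof.
move=> sub; have le3 : 3 <= size (undup s).
  by apply: (@uniq_leq_size _ [:: 1; 2; 3]) => // i; rewrite mem_undup; apply: sub.
by rewrite /loose le3 (leq_trans le3 (size_undup s)) !orbT.
Qed.

Lemma loose_rainbow_le2 (G : sgraph) k : k <= 2 ->
  joins_all loose G k -> joins_all rainbow G k.
Proof.
move=> k2 [c ck H]; exists c => // x y xy; have [p gp lp] := H x y xy; exists p => //.
have sub : {subset map c (path_edges x p) <= [:: 1; 2]}.
  have /and3P[pp _ _] := gp; elim: p x pp {H xy gp lp} => //= z p IH x /andP[xz pp] i.
  rewrite inE => /orP[/eqP->|/(IH _ pp)//].
  by have := ck _ _ xz; rewrite !inE; case: (c _) => [|[|[|m]]] //= /leq_trans/(_ k2).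
have lt3 : size (undup (map c (path_edges x p))) <= 2.
  by apply: (@uniq_leq_size _ _ [:: 1; 2]); rewrite ?undup_uniq // => i; rewrite mem_undup; apply: sub.
move: lp; rewrite /rainbow /loose [in 2 < size (undup _)]ltnNge lt3 andbF orbF.
by case/orP => [|/andP[]//]; case: (map _ _) => [|i [|j s]].
Qed.

(** * The colouring with three colours *)

(** The last test serves an edge that leaves the ball of radius 2 at [w]. If [w] has a neighbour [z]
    other than [a] next to [b], then [bz] has colour 2 and the edge gets 1; if only [a] is
    available, [ba] has colour 1 and the edge gets 2. *)
Definition star_coloring (G : sgraph) (a b : G) (e : {set G}) : nat :=
  if b \in e then (if a \in e then 1 else 2)
  else if [exists z in e, adj b z] then 3
  else if [exists w in e, exists z, [&& z != a, adj b z & adj z w]] then 1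
  else 2.

Lemma star_coloring_edge (G : sgraph) (a b : G) :
  edge_coloring 3 (star_coloring a b).
Proof. by move=> u v _; rewrite /star_coloring; do !case: ifP. Qed.

Lemma star_coloring3 (G : sgraph) (a b u v : G) :
  u != b -> v != b -> adj b u || adj b v -> star_coloring a b [set u; v] = 3.
Proof.
move=> ub vb buv; rewrite /star_coloring !inE ![b == _]eq_sym (negPf ub) (negPf vb) /=.
case: existsP => // -[]; case/orP: buv => [bu|bv].
  by exists u; rewrite set21.
by exists v; rewrite set22.
Qed.

Lemma star_coloring_joined_center (G : sgraph) (a b y : G) :
  connected_graph G -> adj a b -> y != b -> loosely_joined (star_coloring a b) b y.
Proof.
move=> /andP[_ /forall_inP conG] ab yb; set c := star_coloring a b.
have {conG} cyb : connect (@adj G) y b.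
  have /forall_inP/(_ b (in_setT b)) := conG y (in_setT y).
  by apply: connect_sub => s t /and3P[_ _ ?]; apply: connect1.
have [by_|bNy] := boolP (adj b y); first exact: loosely_joined_adj.
have cbz z : adj b z -> c [set b; z] = if z == a then 1 else 2.
  move=> bz; rewrite /c /star_coloring set21 !inE.
  by rewrite (negPf (adj_neq ab)) eq_sym.
have two z w : adj b z -> adj z w -> w != b -> c [set z; w] = 3.
  by move=> bz zw wb; apply: star_coloring3; rewrite ?bz // eq_sym adj_neq.
have [/existsP[z /andP[bz zy]]|Ny] := boolP [exists z, adj b z && adj z y].
  apply: (loosely_joined_path2 (z := z)) => //; first by rewrite eq_sym.
  by rewrite (two z y) // cbz //; case: ifP.
(* [S] is the ball of radius 2 about [b]. A path from [y] is followed to its first vertex [w] in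
   [S], and [t] is the vertex before [w]; so [w] is at distance exactly 2 from [b]. *)
pose S := [pred t | [|| t == b, adj b t | [exists z, adj b z && adj z t]]].
have nSy : ~~ S y by rewrite /= (negPf yb) (negPf bNy) (negPf Ny).
have Sb : S b by rewrite /= eqxx.
have [r [w [pr ur Sw nSr]]] := connect_first_hit cyb nSy Sb.
apply: loosely_joined_sym; set t := last y r.
have nSt : ~~ S t.
  by move: nSr; apply: contraNN => St; apply/hasP; exists t; rewrite // mem_last.
have tw : adj t w by move: pr; rewrite rcons_path => /andP[].
move: (nSt); rewrite /= !negb_or negb_exists => /and3P[tb bNt /forallP bt2].
have wb : w != b by apply: contraNneq bNt => <-; rewrite adj_sym.
have bNw : ~~ adj b w by have := bt2 w; rewrite [adj w t]adj_sym tw andbT.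
(* The colouring tests both ends of the edge, but [t] is outside [S] and has no neighbour adjacent
   to [b], so only [w] can pass. *)
have ctw : c [set t; w] =
    if [exists z, [&& z != a, adj b z & adj z w]] then 1 else 2.
  rewrite /c /star_coloring !inE ![b == _]eq_sym (negPf tb) (negPf wb) /=.
  have /negPf-> : ~~ [exists z in [set t; w], adj b z].
    apply/existsP => -[z /andP[]].
    by rewrite !inE => /orP[] /eqP->; rewrite ?(negPf bNt) ?(negPf bNw).
  congr (if _ then _ else _); apply/existsP/idP => [[v /andP[]]|wz]; last first.
    by exists w; rewrite set22.
  rewrite !inE => /orP[] /eqP-> // /existsP[z /and3P[_ bz zt]].
  by have := bt2 z; rewrite bz zt.
(* Take [z] different from [a] if possible; otherwise the neighbour provided by [w] being in [S] has
   to be [a]. *)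
have [z [bz zw ctwz]] : exists z, [/\ adj b z, adj z w &
    perm_eq [:: c [set t; w]; c [set w; z]; c [set z; b]] [:: 1; 2; 3]].
  rewrite ctw; case: existsP => [[z /and3P[za bz zw]]|Nz].
    exists z; split=> //; rewrite [[set w; z]]setUC two // [[set z; b]]setUC cbz //.
    by rewrite (negPf za).
  move: Sw; rewrite /= (negPf wb) (negPf bNw) /= => /existsP[z /andP[bz zw]].
  exists z; split=> //; rewrite [[set w; z]]setUC two // [[set z; b]]setUC cbz //.
  by case: eqP => // /eqP za; case: Nz; exists z; rewrite za bz.
exists (r ++ [:: w; z; b]).
  apply/and3P; split; last by rewrite last_cat.
    move: pr; rewrite rcons_path cat_path => /andP[-> /= ->] /=.
    by rewrite adj_sym zw adj_sym bz.
  move: ur; rewrite -!rcons_cons rcons_uniq -cat_cons cat_uniq => /andP[_ ->]; rewrite andTb.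
  apply/andP; split; last first.
    by rewrite /= !inE negb_or wb [w == z]eq_sym (adj_neq zw) [z == b]eq_sym (adj_neq bz).
  (* The vertices [w], [z], [b] all lie in the ball, while [y :: r] avoids it. *)
  apply/hasPn => v; rewrite !inE => v3; apply: contraNN nSr => vr.
  by apply/hasP; exists v => //; case/or3P: v3 => /eqP-> //=; rewrite bz orbT.
apply: loose_three_colors => i; rewrite -(perm_mem ctwz) path_edges_cat map_cat mem_cat /= => ->.
exact: orbT.
Qed.

Lemma star_coloring_joined (G : sgraph) (a b x y : G) :
  k_connected 2 G -> adj a b -> x != b -> y != b -> x != y ->
  loosely_joined (star_coloring a b) x y.
Proof.
move=> conG ab xb yb xy.
have aNb : a != b by apply: adj_neq.
have yx : y != x by rewrite eq_sym.
have {yx} := linked_edge conG aNb xb yx.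
case=> p [q [pp qq upq]].
(* The two possible orders of the ends differ by exchanging [x] and [y]. *)
wlog [lp lq] : x y xb yb xy p q pp qq upq / last x p = a /\ last y q = b.
  move=> W; rewrite !inE !xpair_eqE => /orP[] /andP[/eqP lp /eqP lq].
    by apply: (W x y xb yb xy p q) => //; rewrite !inE !xpair_eqE lp lq !eqxx.
  apply: loosely_joined_sym; apply: (W y x yb xb _ q p) => //.
  - by rewrite eq_sym.
  - by rewrite uniq_catC.
  - by rewrite !inE !xpair_eqE lp lq !eqxx.
move=> _.
(* As [y] is not [b], the path from [y] has a last edge. From here on [q] omits the final [b], and
   [d] will be the vertex before it. *)
case/lastP: q qq upq lq => [|q d] qq upq /=; first by move=> yb'; rewrite yb' eqxx in yb.
rewrite last_rcons => db; move: qq upq; rewrite db => qq upq {d db}.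
have up : perm_eq (b :: (x :: p) ++ y :: q) ((x :: p) ++ y :: rcons q b).
  by rewrite -rcons_cons -cats1 catA perm_sym -cat1s perm_catC.
move: (upq); rewrite -(perm_uniq up) cons_uniq => /andP[].
rewrite mem_cat negb_or => /andP[bNp bNq] upq'.
have gq : graph_path b y (rev (y :: q)).
  rewrite -(belast_rcons y q b); apply: graph_path_rev.
  rewrite /graph_path qq last_rcons eqxx andbT /=.
  by move: upq; rewrite cat_uniq => /and3P[].
set d := last y q; have bd : adj d b by move: qq; rewrite rcons_path => /andP[].
have edges : path_edges x (p ++ b :: rev (y :: q)) =
    path_edges x p ++ [:: [set a; b], [set d; b] & rev (path_edges y q)].
  rewrite path_edges_cat /= lp; congr (_ ++ _ :: _).
  rewrite -(belast_rcons y q b) -[X in path_edges X](last_rcons y q b) path_edges_rev.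
  by rewrite -cats1 path_edges_cat rev_cat.
(* [a] and [d] lie on disjoint paths, so [db] is an edge at [b] other than [ab]. *)
have aNd : a != d.
  apply: contraTneq upq' => ad; rewrite cat_uniq; apply/nandP; right.
  by rewrite negb_and negbK; apply/orP; left; apply/hasP; exists d;
    [exact: mem_last | rewrite -ad -lp /= mem_last].
have c1 : star_coloring a b [set a; b] = 1 by rewrite /star_coloring set21 set22.
have c2 : star_coloring a b [set d; b] = 2.
  by rewrite /star_coloring set22 !inE (negPf aNd) (negPf aNb).
exists (p ++ b :: rev (y :: q)).
  have /and3P[pr _ lr] := gq; apply/and3P; split.
  - by rewrite cat_path pp /= lp ab.
  - rewrite -cat_cons uniq_catC cat_cons -cat1s.
    have up' : perm_eq (b :: (x :: p) ++ y :: q) ([:: b] ++ rev (y :: q) ++ x :: p).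
      by rewrite perm_cons perm_catC perm_cat2r perm_sym perm_rev.
    by rewrite -(perm_uniq up') (perm_uniq up).
  - by rewrite last_cat.
rewrite edges map_cat /= c1 c2.
(* With both sequences empty the path is [a], [b], [d], with colours 1 and 2. Otherwise a nonempty
   one has a last edge, which avoids [b] and ends at its neighbour [a] or [d]: its colour is 3. *)
have [/andP[/eqP -> /eqP ->]//|pq] := boolP ((p == [::]) && (q == [::])).
have [e ePQ c3] : exists2 e, e \in path_edges x p ++ path_edges y q &
    star_coloring a b e = 3.
  case/nandP: pq => [/(path_edges_last x)|/(path_edges_last y)] [u uP eP].
    exists [set u; last x p]; first by rewrite mem_cat eP.
    rewrite lp star_coloring3 ?[adj b a]adj_sym ?ab ?orbT //.
    by apply: contraNneq bNp => <-.
  exists [set u; last y q]; first by rewrite mem_cat eP orbT.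
  rewrite star_coloring3 ?[adj b (last y q)]adj_sym ?bd ?orbT ?(adj_neq bd) //.
  by apply: contraNneq bNq => <-.
apply: loose_three_colors => i; rewrite !inE mem_cat !inE map_rev mem_rev.
case/or3P => /eqP->; rewrite ?orbT //.
by move: (map_f (star_coloring a b) ePQ); rewrite c3 map_cat mem_cat => /orP[] ->; rewrite ?orbT.
Qed.

Theorem theorem2 (G : sgraph) (hG : k_connected 2 G) :
  lec G = minn 3 (rc G).
Proof.
have conG := k_connected_connected hG.
have [loose_lec min_lec] := lecP conG.
have [rainbow_rc min_rc] := rcP conG.
have lec3 : lec G <= 3.
  apply: min_lec.
  have [b _] : exists b : G, b \in [set: G] by case/andP: conG => /set0Pn.
  (* The first edge of a path from [b] to any other vertex. *)
  have [a ba] : exists a, adj b a.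
    have [y yb] : exists y, y != b.
      apply/existsP; case/andP: hG => [ltG _]; rewrite -negb_forall.
      apply: contraTN ltG => /forallP all_b; rewrite -leqNgt ltnW // ltnS.
      by apply/card_le1P => y _ z; rewrite !inE (eqP (all_b y)) (eqP (all_b z)) eqxx.
    case/andP: conG => _ /forall_inP/(_ b (in_setT b))/forall_inP/(_ y (in_setT y)).
    case/connectP => [[|a p]] /= => [_ yb'|]; first by rewrite yb' eqxx in yb.
    by case/andP => /and3P[_ _ ba] _ _; exists a.
  have ab : adj a b by rewrite adj_sym.
  exists (star_coloring a b) => [|x y xy]; first exact: star_coloring_edge.
  have [xb|xb] := eqVneq x b.
    by rewrite xb in xy *; apply: star_coloring_joined_center; rewrite // eq_sym.
  have [yb|yb] := eqVneq y b; last exact: star_coloring_joined.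
  by rewrite yb; apply/loosely_joined_sym/star_coloring_joined_center.
have lec_rc : lec G <= rc G by apply/min_lec/joins_all_rainbow_loose.
apply/eqP; rewrite eqn_leq leq_min lec3 lec_rc geq_min /=.
(* If [lec G] is at most 2, an optimal loose colouring is a rainbow one, whence [rc G <= lec G]. *)
by have [//|lt3] := leqP 3 (lec G); apply/min_rc/loose_rainbow_le2.
Qed.
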